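(* The algebraic (in)dependence of an acyclic set of angles is determined by the graph $G$ and the partition of its edges into color classes given by the connected components of the angle graph. Precisely: let $G=(V,E)$ be a graph, $\mathbb{K}$ a field, and let $A$ and $A'$ be two angle index sets of $G$ such that the angle graphs $\tilde G(A)$ and $\tilde G(A')$ are acyclic and the vertex sets of the connected components of $\tilde G(A)$ and of $\tilde G(A')$ define the same partition of $E$. Then $\alpha_A$ is algebraically independent over $\mathbb{K}$ if and only if $\alpha_{A'}$ is algebraically independent over $\mathbb{K}$.
   Context: Graphs are finite and simple. An angle index set $A$ of $G=(V,E)$ is a set of unordered pairs $\{e,f\}$ of distinct edges of $G$. The angle graph $\tilde G(A)$ is the graph with vertex set $E$ and edge set $A$. Let $\mathbb{K}(x_v,y_v:v\in V)$ be the field of rational functions in $2|V|$ algebraically independent variables. For an edge $e=uv$ put $X_e=x_u-x_v$, $Y_e=y_u-y_v$ and for $e,f\in E$ put $\alpha_{ef}=X_eY_fX_f^{-1}Y_e^{-1}$ (this does not depend on the order of the endpoints of $e$ or $f$). Set $\alpha_A=\{\alpha_{ef}:\{e,f\}\in A\}$, where for each unordered pair one of the two orderings is chosen (the choice is immaterial since $\alpha_{ef}=\alpha_{fe}^{-1}$). *)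

(* Defs.v *)
From HB Require Import structures.
From mathcomp Require Import all_boot all_order all_algebra.
From mathcomp Require Import mpoly.

Set Implicit Arguments.
Unset Strict Implicit.
Unset Printing Implicit Defensive.

Import GRing.Theory.

Record sgraph := SGraph {
  vertex :> finType;
  edges : {set {set vertex}};
  card_edge : forall e, e \in edges -> #|e| = 2
}.

Definition edge (G : sgraph) : finType := {e : {set G} | e \in edges G}.

Definition adj (G : sgraph) : rel G := [rel u v | [set u; v] \in edges G].

Definition acyclic (G : sgraph) : Prop :=
  forall s : seq G, (3 <= size s)%N -> ~ ucycle (@adj G) s.

Definition components (G : sgraph) : {set {set G}} :=
  equivalence_partition (connect (@adj G)) [set: G].

(* An orientation lists the two endpoints of every edge in some order. *)
Record orientation (G : sgraph) := Orientation {
  ends :> edge G -> G * G;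
  endsP : forall e, val e = [set (ends e).1; (ends e).2]
}.

Lemma orientation_inhabited (G : sgraph) : inhabited (orientation G).
Proof.
have ex (e : edge G) : exists p : G * G, val e == [set p.1; p.2].
  have /eqP/cards2P [u [v [_ ->]]] := card_edge (valP e).
  by exists (u, v).
split; apply: (@Orientation G (fun e => xchoose (ex e))) => e.
exact/eqP/(xchooseP (ex e)).
Qed.

Record angle_set (G : sgraph) := AngleSet {
  angles : {set {set edge G}};
  card_angle : forall a, a \in angles -> #|a| = 2
}.

Definition angle_graph (G : sgraph) (A : angle_set G) : sgraph :=
  SGraph (@card_angle G A).

Local Open Scope ring_scope.

Section Angles.

Variables (K : fieldType) (G : sgraph).

(* The first #|G| variables are the x_v, the last #|G| ones are the y_v. *)
Definition ratfun : fieldType := {fraction {mpoly K[#|G| + #|G|]}}.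

Definition ratfun_const : {rmorphism K -> ratfun} :=
  [the {rmorphism K -> ratfun} of
    @tofrac {mpoly K[#|G| + #|G|]} \o @mpolyC (#|G| + #|G|) K].

Definition xvar (v : G) : ratfun := tofrac 'X_(lshift #|G| (enum_rank v)).
Definition yvar (v : G) : ratfun := tofrac 'X_(rshift #|G| (enum_rank v)).

Definition Xedge (o : orientation G) (e : edge G) : ratfun := xvar (o e).1 - xvar (o e).2.
Definition Yedge (o : orientation G) (e : edge G) : ratfun := yvar (o e).1 - yvar (o e).2.

Definition alpha (o : orientation G) (e f : edge G) : ratfun :=
  Xedge o e * Yedge o f * (Xedge o f)^-1 * (Yedge o e)^-1.

Lemma alpha_orientation (o o' : orientation G) (e f : edge G) :
  alpha o e f = alpha o' e f.
Proof.
have flip (g : edge G) :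
    (o g = o' g) \/ ((o g).1 = (o' g).2 /\ (o g).2 = (o' g).1).
  have := endsP o g; rewrite (endsP o' g).
  case: (o g) (o' g) => [a b] [c d] /= E.
  have /set2P Ha : a \in [set c; d] by rewrite E set21.
  have /set2P Hb : b \in [set c; d] by rewrite E set22.
  have /set2P Hc : c \in [set a; b] by rewrite -E set21.
  have /set2P Hd : d \in [set a; b] by rewrite -E set22.
  by case: Ha => ?; case: Hb => ?; case: Hc => ?; case: Hd => ?; subst; auto.
have XY (g : edge G) : exists b : bool,
    Xedge o g = (-1) ^+ b * Xedge o' g /\ Yedge o g = (-1) ^+ b * Yedge o' g.
  rewrite /Xedge /Yedge; case: (flip g) => [->|[-> ->]].
    by exists false; rewrite !mul1r.
  by exists true; rewrite !mulN1r !opprB.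
have [b [Xe Ye]] := XY e; have [c [Xf Yf]] := XY f.
rewrite /alpha Xe Ye Xf Yf; case: b c {Xe Ye Xf Yf} => [] [];
by rewrite ?expr1 ?expr0 ?mul1r ?mulN1r ?invrN ?mulrN ?mulNr ?mulrN ?opprK.
Qed.

Lemma alphaV (o : orientation G) (e f : edge G) :
  alpha o e f = (alpha o f e)^-1.
Proof.
by rewrite /alpha !invfM !invrK -!mulrA [RHS]mulrC -!mulrA [RHS]mulrC -!mulrA.
Qed.

(* The orientation of the angle graph selects, for each unordered pair {e, f}
   in A, one of alpha e f and alpha f e. *)
Definition alpha_set (o : orientation G) (A : angle_set G)
    (oA : orientation (angle_graph A)) : seq ratfun :=
  [seq alpha o (oA a).1 (oA a).2 | a : edge (angle_graph A)].

End Angles.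

(* Algebraic independence of a set S of elements of L (not of a family):
   only pairwise distinct elements of S are substituted. *)
Definition alg_independent (K L : fieldType) (iota : {rmorphism K -> L})
    (S : {pred L}) : Prop :=
  forall (n : nat) (t : 'I_n -> L),
    injective t -> (forall i, t i \in S) ->
  forall p : {mpoly K[n]}, mmap iota t p = 0 -> p = 0.

(* Main.v *)
Require Import Defs.
From HB Require Import structures.
From mathcomp Require Import all_boot all_order all_algebra.
From mathcomp Require Import mpoly.

Set Implicit Arguments.
Unset Strict Implicit.
Unset Printing Implicit Defensive.

Import Order.TTheory GRing.Theory Num.Theory.
Local Open Scope ring_scope.

(** Put r_e = X_e / Y_e, the slope of the edge e, so that
    alpha_ef = r_e / r_f.

    A finite set S of nonzero elements of an extension of K is algebraically
    independent if and only if S is multiplicatively independent and the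
    multiplicative group generated by S is linearly independent over K: the
    elements of this group are the Laurent monomials in S, and a common factor
    makes all the exponents of a Laurent polynomial nonnegative.  Hence only
    two facts about angles are needed.

    The group generated by alpha_A depends only on the components of the angle
    graph: along a path from e to f, the product of the ratios of consecutive
    slopes telescopes to r_e / r_f ([connect_mult_gen]).

    If the angle graph is acyclic, then alpha_A is multiplicatively independent
    ([alpha_set_mult_independent]).  Indeed a monomial in alpha_A is a monomial
    in the slopes, whose exponent vector is the boundary of the given exponents
    seen as a 1-chain on the angle graph.  The slopes are multiplicatively
    independent, because identifying the two variables x_u and x_v at the ends
    of e kills X_e but no other X_f and no Y_f ([slope_mult_independent]).  The
    boundary map of a forest is injective, because every edge is a bridge
    ([acyclic_boundary_inj]).

    So if alpha_A is algebraically independent, its group is linearly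
    independent; this is also the group of alpha_A', which is multiplicatively
    independent, hence algebraically independent. *)

(** * Algebraic independence and multiplicative groups *)

Definition mult_independent (L : fieldType) (I : finType) (r : I -> L) : Prop :=
  forall z : I -> int, \prod_i r i ^ z i = 1 -> forall i, z i = 0.

(** The multiplicative group generated by S.  The exponents are a function on
    L, which is why the repetitions in S are removed. *)
Definition mult_gen (L : fieldType) (S : seq L) (x : L) : Prop :=
  exists z : L -> int, x = \prod_(s <- undup S) s ^ z s.

Section MultGen.

Variables (L : fieldType) (S : seq L).
Hypothesis S_neq0 : 0 \notin S.

Lemma mult_gen1 : mult_gen S 1.
Proof. by exists (fun=> 0); rewrite big1. Qed.

Lemma mult_genM x y : mult_gen S x -> mult_gen S y -> mult_gen S (x * y).
Proof.
move=> [z ->] [z' ->]; exists (fun s => z s + z' s).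
rewrite -big_split; apply: eq_big_seq => s; rewrite mem_undup => Ss.
by rewrite expfzDr //; apply: contraNneq S_neq0 => <-.
Qed.

Lemma mult_genV x : mult_gen S x -> mult_gen S x^-1.
Proof.
move=> [z ->]; exists (fun s => - z s).
by rewrite -prodfV; apply: eq_bigr => s _; rewrite invr_expz.
Qed.

Lemma mem_mult_gen x : x \in S -> mult_gen S x.
Proof.
move=> Sx; exists (fun s => (s == x)%:Z).
rewrite (bigD1_seq x) ?mem_undup ?undup_uniq //= eqxx big1 ?mulr1 // => s.
by move/negPf->.
Qed.

Lemma mult_gen_prod n (t : 'I_n -> L) (m : 'I_n -> nat) :
  (forall i, mult_gen S (t i)) -> mult_gen S (\prod_i t i ^+ m i).
Proof.
move=> St; apply: big_ind => [||i _]; [exact: mult_gen1|exact: mult_genM|].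
elim: (m i) => [|k IHk]; first exact: mult_gen1.
by rewrite exprS; apply: mult_genM.
Qed.

(** A linear relation between Laurent monomials in S, multiplied by a high power
    of the product of S, is a polynomial relation between the elements of S.
    Its coefficients are those of the given relation, since distinct elements of
    the group cannot come from the same exponents. *)
Lemma lin_indep_mult_gen (K : fieldType) (iota : {rmorphism K -> L})
    d (g : 'I_d -> L) (c : 'I_d -> K) :
    alg_independent iota (mem S) ->
    injective g -> (forall k, mult_gen S (g k)) ->
  \sum_k iota (c k) * g k = 0 -> forall k, c k = 0.
Proof.
move=> indS g_inj /fin_all_exists [z gE] sum0.
pose n := size (undup S); pose t := tnth (in_tuple (undup S)).
have tS i : t i \in S by rewrite -mem_undup (mem_tnth i (in_tuple (undup S))).
have t_neq0 i : t i != 0 by apply: contraNneq S_neq0 => <-.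
(* the power of the product of S that makes all exponents nonnegative *)
pose N := (\max_k \max_i `|z k (t i)|)%N.
have N_ge k i : 0 <= z k (t i) + N%:Z.
  have: (`|z k (t i)| <= N)%N.
    by apply: leq_trans (leq_bigmax k); apply: (leq_bigmax i).
  by rewrite -lez_nat abszE ler_norml -subr_ge0 opprK => /andP[].
pose m k := [multinom absz (z k (t i) + N%:Z)%R | i < n].
have mE k : mmap1 t (m k) = g k * \prod_i t i ^+ N.
  rewrite gE big_tnth -big_split /mmap1; apply: eq_bigr => i _.
  by rewrite mnmE exprnP gez0_abs //; apply: expfzDr.
have tN_neq0 : \prod_i t i ^+ N != 0.
  by apply/prodf_neq0 => i _; rewrite expf_neq0.
have m_inj : injective m.
  by move=> j k /(congr1 (mmap1 t)); rewrite !mE => /(mulIf tN_neq0)/g_inj.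
pose p : {mpoly K[n]} := \sum_k c k *: 'X_[m k].
have p0 : p = 0.
  apply: (indS n t) => //.
    by apply/tuple_uniqP; apply: undup_uniq.
  transitivity ((\sum_k iota (c k) * g k) * \prod_i t i ^+ N).
    rewrite raddf_sum big_distrl; apply: eq_bigr => k _ /=.
    by rewrite mmapZ mmapX mE mulrA.
  by rewrite sum0 mul0r.
move=> k; have := congr1 (mcoeff (m k)) p0; rewrite mcoeff0 raddf_sum /=.
rewrite (bigD1 k) //= mcoeffZ mcoeffX eqxx mulr1 big1 ?addr0 // => j neq_jk.
by rewrite mcoeffZ mcoeffX (inj_eq m_inj) (negPf neq_jk) mulr0.
Qed.

(** A polynomial relation between elements of S' is a linear relation between
    monomials in S'.  These lie in the group generated by S, and they are
    distinct because S' is multiplicatively independent. *)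
Lemma alg_independent_mult_gen (K : fieldType) (iota : {rmorphism K -> L})
    (S' : seq L) :
    alg_independent iota (mem S) ->
    (forall x, x \in S' -> mult_gen S x) ->
    (forall n (t : 'I_n -> L), injective t -> (forall i, t i \in S') ->
       mult_independent t) ->
  alg_independent iota (mem S').
Proof.
move=> indS S'S mindS' n t t_inj tS' p p0.
have t_gen i : mult_gen S (t i) by apply: S'S; apply: tS'.
have t_neq0 i : t i != 0.
  have [z ->] := t_gen i; rewrite prodf_seq_neq0; apply/allP => s.
  by rewrite mem_undup => Ss; apply: expfz_neq0; apply: contraNneq S_neq0 => <-.
have mon_inj : injective (mmap1 t).
  move=> m m' eq_mm'; apply/mnmP => i.
  have: \prod_j t j ^ ((m j)%:Z - (m' j)%:Z) = 1.
    transitivity (mmap1 t m / mmap1 t m').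
      rewrite /mmap1 -prodf_div; apply: eq_bigr => j _.
      by rewrite expfzDr // -invr_expz.
    rewrite eq_mm' divff // /mmap1.
    by apply/prodf_neq0 => j _; exact: expf_neq0.
  by move/(mindS' n t t_inj tS')/(_ i)/eqP; rewrite subr_eq0 => /eqP [].
apply/eqP; rewrite -msupp_eq0 -size_eq0 -leqn0 leqNgt.
apply/negP => supp_gt0; pose k0 := Ordinal supp_gt0.
pose m_ := tnth (in_tuple (msupp p)).
have m_inj : injective m_ by apply/tuple_uniqP; apply: msupp_uniq.
have := @lin_indep_mult_gen K iota _ (mmap1 t \o m_) (fun k => p@_(m_ k)) indS
  (inj_comp mon_inj m_inj).
have: p@_(m_ k0) != 0.
  by rewrite -mcoeff_msupp; apply: (mem_tnth k0 (in_tuple (msupp p))).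
move=> /eqP nz /(_ _ _ k0) H; apply: nz; apply: H => [k|].
  exact: mult_gen_prod.
by move: p0; rewrite {1}/mmap big_tnth.
Qed.

End MultGen.

(** * Boundaries of chains on a forest *)

Lemma expfz_sum (L : fieldType) (x : L) (I : finType) (P : pred I)
    (F : I -> int) :
  x != 0 -> x ^ (\sum_(i | P i) F i) = \prod_(i | P i) x ^ F i.
Proof.
by move=> x0; apply: (big_morph (fun k => x ^ k)) => // m n; apply: expfzDr.
Qed.

Section Forest.

Variable H : sgraph.

Lemma adj_sym : ssrbool.symmetric (@adj H).
Proof. by move=> u v; rewrite /adj /= setUC. Qed.

Lemma edge_ends (o : orientation H) (a : edge H) :
  [set (o a).1; (o a).2] = val a.
Proof. by rewrite (endsP o). Qed.

Lemma ends_neq (o : orientation H) (a : edge H) : (o a).1 != (o a).2.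
Proof.
by have := card_edge (valP a); rewrite -(edge_ends o) cards2; case: eqP.
Qed.

(** A simple path joining the ends of an edge and avoiding that edge would close
    up to a cycle. *)
Lemma acyclic_bridge (a : edge H) (u v : H) :
    acyclic H -> val a = [set u; v] ->
  ~~ connect [rel x y | adj x y && ([set x; y] != val a)] u v.
Proof.
move=> acH aE; set D := [rel x y | _].
apply/negP => /connectP [q /shortenP [p pD p_uniq _] v_last].
have neq_uv : u != v.
  by have := card_edge (valP a); rewrite aE cards2; case: eqP.
apply: (acH (u :: p)); last first.
  rewrite /ucycle p_uniq andbT /= rcons_path -v_last.
  have /sub_path -> // : subrel D (@adj H) by move=> x y /andP[].
  by rewrite /adj /= setUC -aE (valP a).
case: p pD v_last {p_uniq} => [|x [|y p]] //= pD v_last.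
  by rewrite v_last eqxx in neq_uv.
by case/andP: pD => /andP[_]; rewrite -v_last aE eqxx.
Qed.

(** Delete the edge a and sum the boundary over the component C of one end of a:
    the edges other than a have both ends in C or none and so contribute 0,
    while a, being a bridge, contributes its own coefficient. *)
Lemma acyclic_boundary_inj (o : orientation H) (z : edge H -> int) :
    acyclic H ->
    (forall v, \sum_a z a * (((o a).1 == v)%:Z - ((o a).2 == v)%:Z) = 0) ->
  forall a, z a = 0.
Proof.
move=> acH dz0 a.
pose D := [rel x y : H | adj x y && ([set x; y] != val a)].
pose C := connect D (o a).1.
have D_sym : ssrbool.symmetric D by move=> x y; rewrite /D /= adj_sym setUC.
have sumC (u : H) : \sum_(v | C v) (u == v)%:Z = (C u)%:Z.
  have [Cu|nCu] := boolP (C u).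
    rewrite (bigD1 u) //= eqxx big1 ?addr0 // => v /andP[_].
    by rewrite eq_sym => /negPf->.
  rewrite big1 // => v Cv; case: eqP => // uv.
  by rewrite uv Cv in nCu.
have: \sum_(v | C v) \sum_b z b * (((o b).1 == v)%:Z - ((o b).2 == v)%:Z) = 0.
  by rewrite big1.
rewrite exchange_big (bigD1 a) //= [X in _ + X]big1 => [|b neq_ba].
  rewrite addr0 -mulr_sumr big_split sumrN /= !sumC.
  have -> : C (o a).1 by apply: connect0.
  have /negPf-> : ~~ C (o a).2 by apply: acyclic_bridge; rewrite ?(endsP o).
  by rewrite subr0 mulr1.
rewrite -mulr_sumr big_split sumrN /= !sumC.
have -> : C (o b).1 = C (o b).2; last by rewrite subrr mulr0.
apply: (same_connect_r (sym_connect_sym D_sym)); apply: connect1.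
by rewrite /D /adj /= edge_ends (valP b) (inj_eq val_inj).
Qed.

Lemma boundary_prod (L : fieldType) (o : orientation H) (r : H -> L)
    (z : edge H -> int) :
    (forall v, r v != 0) ->
  \prod_a (r (o a).1 / r (o a).2) ^ z a =
  \prod_v r v ^ (\sum_a z a * (((o a).1 == v)%:Z - ((o a).2 == v)%:Z)).
Proof.
move=> r_neq0.
under [RHS]eq_bigr => v _ do rewrite expfz_sum //.
rewrite exchange_big; apply: eq_bigr => a _ /=.
have proddelta (u : H) : \prod_v r v ^ (u == v)%:Z = r u.
  rewrite (bigD1 u) //= eqxx big1 ?mulr1 // => v.
  by rewrite eq_sym => /negPf->.
rewrite -{1}(proddelta (o a).1) -{1}(proddelta (o a).2) -prodf_div.
rewrite (big_morph (fun x => x ^ z a) (id1 := 1) (op1 := *%R)) ?exp1rz //.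
  apply: eq_bigr => v _.
  by rewrite [z a * _]mulrC -exprz_exp expfzDr // -invr_expz.
by move=> x y; apply: expfzMl.
Qed.

Lemma acyclic_mult_independent (L : fieldType) (o : orientation H)
    (r : H -> L) :
    acyclic H -> (forall v, r v != 0) -> mult_independent r ->
  mult_independent (fun a => r (o a).1 / r (o a).2).
Proof.
move=> acH r_neq0 indr z; rewrite boundary_prod // => /indr.
exact: acyclic_boundary_inj.
Qed.

End Forest.

(** The exponents on I are pushed forward to J by summing over the fibres
    of h. *)
Lemma mult_independent_comp (L : fieldType) (I J : finType) (r : J -> L)
    (h : I -> J) :
    (forall j, r j != 0) -> injective h -> mult_independent r ->
  mult_independent (r \o h).
Proof.
move=> r_neq0 h_inj indr z rz1 i.
have <- : \sum_(k | h k == h i) z k = z i.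
  by rewrite (big_pred1 i) // => k; rewrite (inj_eq h_inj).
apply: (indr (fun j => \sum_(k | h k == j) z k)).
rewrite -[RHS]rz1 (partition_big h xpredT) //=; apply: eq_bigr => j _.
by rewrite expfz_sum //; apply: eq_bigr => k /eqP->.
Qed.

(** * Multiplicative independence of the slopes *)

Section Substitution.

Variables (R : idomainType) (I : finType) (x y : I -> R).

(** Clearing denominators turns a multiplicative relation between the ratios
    into an equality of products of powers of the x_j and y_j.  If the exponent
    of the i-th ratio is not 0, then x_i occurs on one side only, so a
    substitution killing x_i but no other factor contradicts this equality. *)
Lemma mult_independent_ratio :
    (forall i, x i != 0) -> (forall i, y i != 0) ->
    (forall i, exists s : {rmorphism R -> R}, [/\ s (x i) = 0,
       forall j, s (y j) != 0 & forall j, j != i -> s (x j) != 0]) ->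
  mult_independent (fun i => tofrac (x i) / tofrac (y i)).
Proof.
move=> x_neq0 y_neq0 subst z ratio1.
have no_relation (a b : I -> nat) i :
    \prod_j (x j ^+ a j * y j ^+ b j) = \prod_j (x j ^+ b j * y j ^+ a j) ->
  b i = 0%N -> a i = 0%N.
  have [s [sx0 sy_neq0 sx_neq0]] := subst i.
  move=> /(congr1 s); rewrite !rmorph_prod => eq_s bi0; apply/eqP.
  rewrite -leqn0 leqNgt; apply/negP => ai_gt0.
  have: \prod_j s (x j ^+ b j * y j ^+ a j) != 0.
    apply/prodf_neq0 => j _; rewrite rmorphM !rmorphXn.
    apply: mulf_neq0; last exact: expf_neq0.
    have [->|/sx_neq0] := eqVneq j i; last exact: expf_neq0.
    by rewrite bi0 oner_eq0.
  rewrite -eq_s (bigD1 i) //= rmorphM rmorphXn sx0 expr0n.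
  by rewrite (gtn_eqF ai_gt0) !mul0r eqxx.
(* a and b are the positive and the negative part of z *)
pose a i := if 0 <= z i then `|z i|%N else 0%N.
pose b i := if 0 <= z i then 0%N else `|z i|%N.
have tofrac_neq0 (u : R) : u != 0 -> tofrac u != 0 by rewrite tofrac_eq0.
have cleared : \prod_j (x j ^+ a j * y j ^+ b j) =
               \prod_j (x j ^+ b j * y j ^+ a j).
  apply/eqP; rewrite -tofrac_eq !rmorph_prod.
  have Q_neq0 : \prod_j tofrac (x j ^+ b j * y j ^+ a j) != 0.
    by apply/prodf_neq0 => j _; rewrite tofrac_neq0 // mulf_neq0 ?expf_neq0.
  apply/eqP/(divIf Q_neq0); rewrite divff // -[RHS]ratio1 -prodf_div.
  apply: eq_bigr => j _.
  rewrite !rmorphM !rmorphXn /a /b; case: ifP => zj.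
    by rewrite !expr0 mulr1 mul1r -{3}[z j]gez0_abs // -exprnP expr_div_n.
  have zj0 : z j <= 0 by rewrite ltW // ltNge zj.
  rewrite !expr0 mulr1 mul1r [in RHS](_ : z j = - `|z j|%N%:Z).
    by rewrite -exprz_inv -exprnP invf_div expr_div_n.
  by rewrite lez0_abs ?opprK.
move=> i; have := no_relation b a i (esym cleared).
have := no_relation a b i cleared; rewrite /a /b; case: ifP => _.
  by move/(_ erefl) /eqP; rewrite absz_eq0 => /eqP.
by move=> _ /(_ erefl) /eqP; rewrite absz_eq0 => /eqP.
Qed.

End Substitution.

Lemma mpolyX_sub_neq0 (K : fieldType) n (i j : 'I_n) :
  i != j -> 'X_i - 'X_j != 0 :> {mpoly K[n]}.
Proof.
move=> neq_ij; rewrite subr_eq0; apply: contra neq_ij => /eqP.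
move/(congr1 (mcoeff U_(i))); rewrite !mcoeffX eqxx eq_mnm1 eq_sym.
by case: eqP => // _ /eqP; rewrite oner_eq0.
Qed.

Section Angles.

Variables (K : fieldType) (G : sgraph) (o : orientation G).

Definition slope (e : edge G) : ratfun K G := Xedge K o e / Yedge K o e.

Lemma alphaE e f : alpha K o e f = slope e / slope f.
Proof.
rewrite /alpha /slope invfM invrK -!mulrA; congr (_ * _).
by rewrite mulrC -mulrA [RHS]mulrCA.
Qed.

Local Notation P := {mpoly K[#|G| + #|G|]}.
Let x (v : G) : P := 'X_(lshift #|G| (enum_rank v)).
Let y (v : G) : P := 'X_(rshift #|G| (enum_rank v)).

Definition Xpoly e : P := x (o e).1 - x (o e).2.
Definition Ypoly e : P := y (o e).1 - y (o e).2.

Let x_sub_neq0 (u v : G) : u != v -> x u - x v != 0.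
Proof.
by move=> ?; apply: mpolyX_sub_neq0; rewrite eq_lshift (inj_eq enum_rank_inj).
Qed.

Lemma Xpoly_neq0 e : Xpoly e != 0.
Proof. by apply: x_sub_neq0; apply: ends_neq. Qed.

Lemma Ypoly_neq0 e : Ypoly e != 0.
Proof.
apply: mpolyX_sub_neq0; rewrite eq_rshift (inj_eq enum_rank_inj).
exact: ends_neq.
Qed.

Lemma slopeE e : slope e = tofrac (Xpoly e) / tofrac (Ypoly e).
Proof. by rewrite /slope /Xedge /Yedge /Xpoly /Ypoly !rmorphB. Qed.

Lemma slope_neq0 e : slope e != 0.
Proof.
rewrite slopeE; apply: mulf_neq0; first by rewrite tofrac_eq0 Xpoly_neq0.
by rewrite invr_eq0 tofrac_eq0 Ypoly_neq0.
Qed.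

(** The substitution x_u := x_w, where e = uw.  It kills X_f only if the
    contraction of u to w identifies the ends of f, that is if f = e because G
    is simple. *)
Lemma contraction_subst e : exists s : {rmorphism P -> P},
  [/\ s (Xpoly e) = 0, forall f, s (Ypoly f) != 0 &
      forall f, f != e -> s (Xpoly f) != 0].
Proof.
set u := (o e).1; set w := (o e).2.
pose c v := if v == u then w else v.
pose h (i : 'I_(#|G| + #|G|)) : P :=
  if i == lshift #|G| (enum_rank u) then x w else 'X_i.
pose s : {rmorphism P -> P} :=
  [the {rmorphism P -> P} of mmap (@mpolyC (#|G| + #|G|) K) h].
have sX i : s 'X_i = h i by rewrite /s /= mmapX mmap1U.
have sx v : s (x v) = x (c v).
  by rewrite sX /h eq_lshift (inj_eq enum_rank_inj) /c; case: ifP.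
have sy v : s (y v) = y v by rewrite sX /h eq_rlshift.
exists s; split=> [|f|f neq_fe]; rewrite rmorphB ?sx ?sy.
- by rewrite /c eqxx eq_sym (negPf (ends_neq o e)) subrr.
- exact: Ypoly_neq0.
apply: x_sub_neq0; apply: contra neq_fe => /eqP eq_c.
rewrite -(inj_eq val_inj) (endsP o e) (endsP o f) -/u -/w; apply/eqP.
have := ends_neq o f; move: eq_c; rewrite /c.
case: eqP => [->|_]; case: eqP => [->|_]; first by rewrite eqxx.
- by move=> <-.
- by move=> ->; rewrite setUC.
- by move=> ->; rewrite eqxx.
Qed.

Lemma slope_mult_independent : mult_independent slope.
Proof.
move=> z z1.
apply: (mult_independent_ratio Xpoly_neq0 Ypoly_neq0 contraction_subst).
by rewrite -[RHS]z1; apply: eq_bigr => e _; rewrite slopeE.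
Qed.

(** * Angles along the components of the angle graph *)

Variable A : angle_set G.
Variable oA : orientation (angle_graph A).

Lemma alpha_setP t :
  reflect (exists a, t = slope (oA a).1 / slope (oA a).2)
          (t \in alpha_set K o oA).
Proof.
apply: (iffP mapP) => [[a _ ->]|[a ->]]; exists a; rewrite ?mem_enum //.
  exact: alphaE.
by rewrite alphaE.
Qed.

Lemma alpha_set_neq0 : 0 \notin alpha_set K o oA.
Proof.
apply/negP => /alpha_setP [a] /esym/eqP; apply/negP.
by rewrite mulf_neq0 ?invr_eq0 ?slope_neq0.
Qed.

(** The ratio of slopes telescopes along a path.  For each step e, g of the
    path, alpha_A contains either r_e / r_g or its inverse. *)
Lemma connect_mult_gen (e f : edge G) :
    connect (@adj (angle_graph A)) e f ->
  mult_gen (alpha_set K o oA) (slope e / slope f).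
Proof.
have S_neq0 := alpha_set_neq0.
case/connectP => p; elim: p e => [|g p IHp] e /=.
  by move=> _ ->; rewrite divff ?slope_neq0 //; apply: mult_gen1.
case/andP => eg /IHp {}IHp /IHp gf.
have -> : slope e / slope f = (slope e / slope g) * (slope g / slope f).
  by rewrite mulrA mulfVK ?slope_neq0.
apply: mult_genM => //.
pose a : edge (angle_graph A) := exist _ [set e; g] eg.
have /alpha_setP aS : exists b, slope (oA a).1 / slope (oA a).2 =
   slope (oA b).1 / slope (oA b).2 by exists a.
have := endsP oA a; have := ends_neq oA a; move: aS.
case: (oA a) => u v /= aS neq_uv eq_uv.
have : u \in [set e; g] by rewrite eq_uv set21.
have : v \in [set e; g] by rewrite eq_uv set22.
move=> /set2P [] vE /set2P [] uE; subst u v; rewrite ?eqxx // in neq_uv.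
  by rewrite -invf_div; apply: mult_genV; apply: mem_mult_gen.
exact: mem_mult_gen.
Qed.

Lemma alpha_set_mult_independent n (t : 'I_n -> ratfun K G) :
    acyclic (angle_graph A) -> injective t ->
    (forall i, t i \in alpha_set K o oA) ->
  mult_independent t.
Proof.
move=> acA t_inj tS.
have /fin_all_exists [a tE] i := alpha_setP _ (tS i).
have a_inj : injective a by move=> i j eq_a; apply: t_inj; rewrite !tE eq_a.
have := @acyclic_mult_independent (angle_graph A) _ oA slope acA slope_neq0
  slope_mult_independent.
move/(mult_independent_comp _ a_inj) => ind z z1.
apply: ind => [b|]; first by rewrite mulf_neq0 ?invr_eq0 ?slope_neq0.
by rewrite -[RHS]z1; apply: eq_bigr => i _; rewrite tE.
Qed.

End Angles.

Lemma components_connect (H : sgraph) (u v : H) :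
  (v \in pblock (components H) u) = connect (@adj H) u v.
Proof.
apply: (pblock_equivalence_partition (R := connect (@adj H))); rewrite ?inE //.
move=> a b c _ _ _; split; first exact: connect0.
by move/(same_connect (sym_connect_sym (@adj_sym H))).
Qed.

(** Each alpha_ef with {e,f} in A' lies in the group generated by alpha_A,
    because e and f are also connected in the angle graph of A.  So linear
    independence passes from that group to the monomials in alpha_A', and these
    are distinct since the angle graph of A' is a forest. *)
Lemma alg_independent_transfer (K : fieldType) (G : sgraph) (o : orientation G)
    (A A' : angle_set G)
    (oA : orientation (angle_graph A)) (oA' : orientation (angle_graph A')) :
    acyclic (angle_graph A') ->
    components (angle_graph A) = components (angle_graph A') ->
    alg_independent (ratfun_const K G) (mem (alpha_set K o oA)) ->
  alg_independent (ratfun_const K G) (mem (alpha_set K o oA')).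
Proof.
move=> acA' eqC indA.
have S_neq0 := alpha_set_neq0 K o oA.
apply: (alg_independent_mult_gen S_neq0 indA) => [t|n t]; last first.
  exact: alpha_set_mult_independent.
case/alpha_setP => a ->; apply: connect_mult_gen.
have := @components_connect (angle_graph A) (oA' a).1 (oA' a).2.
rewrite eqC => <-.
rewrite (@components_connect (angle_graph A') (oA' a).1); apply: connect1.
by rewrite /adj /= (edge_ends oA') (valP a).
Qed.

Theorem corollary5p4 (K : fieldType) (G : sgraph) (o : orientation G)
    (A A' : angle_set G)
    (oA : orientation (angle_graph A)) (oA' : orientation (angle_graph A')) :
  acyclic (angle_graph A) -> acyclic (angle_graph A') ->
  components (angle_graph A) = components (angle_graph A') ->
  alg_independent (ratfun_const K G) (mem (alpha_set K o oA)) <->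
  alg_independent (ratfun_const K G) (mem (alpha_set K o oA')).
Proof.
by move=> acA acA' eqC; split; apply: alg_independent_transfer.
Qed.
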